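(* There exists an absolute constant $c > 0$ such that the following holds. Let $m \ge n \ge 2$ be integers, and let $R, B \subset \mathbb{R}^2$ be disjoint finite sets with $|R| = n$ and $|B| = m$ such that $R \cup B$ is in general position. Then the number of empty red-red-blue triangles in $R \cup B$ is at least $c\, n^{3/2}$.
   Context: A set of points in the plane is in general position if no three of its points are collinear. Points of $R$ are called red and points of $B$ are called blue. Three distinct points $a, b, c \in R \cup B$ form an empty triangle if $\operatorname{conv}(\{a,b,c\}) \cap (R \cup B) = \{a,b,c\}$, where $\operatorname{conv}$ denotes the convex hull. An empty triangle is red-red-blue if exactly two of its vertices are in $R$ and exactly one is in $B$. Triangles are counted as unordered triples $\{a,b,c\}$. *)

(* Defs.v *)
From mathcomp Require Export all_boot all_order all_algebra finmap.
From mathcomp Require Export boolp classical_sets reals exp convex.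

Set Implicit Arguments.
Unset Strict Implicit.
Unset Printing Implicit Defensive.

Import Order.TTheory GRing.Theory Num.Theory.

Local Open Scope classical_set_scope.
Local Open Scope ring_scope.

Section Defs.
Variable R : realType.

Definition convex_hull (A : set 'rV[R]_2) : set 'rV[R]_2 :=
  smallest (@convex_set R 'rV[R]_2) A.

Definition collinear (A : set 'rV[R]_2) : Prop :=
  exists p v : 'rV[R]_2, v != 0 /\
    A `<=` [set q | exists t : R, q = p + t *: v].

Definition general_position (P : {fset 'rV[R]_2}) : Prop :=
  forall t : {fset 'rV[R]_2},
    (t `<=` P)%fset -> #|` t| = 3%N -> ~ collinear [set` t].

(* A triangle is represented by its set of vertices, i.e. by an unordered
   triple of distinct points. *)
Definition empty_triangle (P t : {fset 'rV[R]_2}) : Prop :=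
  [/\ (t `<=` P)%fset, #|` t| = 3%N &
      (convex_hull [set` t] `&` [set` P]) = [set` t]].

Definition red_red_blue (Rd Bl t : {fset 'rV[R]_2}) : Prop :=
  #|` (t `&` Rd)%fset| = 2%N /\ #|` (t `&` Bl)%fset| = 1%N.

Definition empty_red_red_blue_triangles (Rd Bl : {fset 'rV[R]_2}) :
    {fset {fset 'rV[R]_2}} :=
  [fset t in fpowerset (Rd `|` Bl)%fset
    | `[< empty_triangle (Rd `|` Bl)%fset t /\ red_red_blue Rd Bl t >]]%fset.

End Defs.

(* Main.v *)
Require Import Defs.
From mathcomp Require Import unstable interval_inference zify ring lra.

(** Write [E] for the set of empty red-red-blue triangles, [n] for the number
of red points, and [r], [b] for the numbers of red and blue points of the
configuration under consideration.

The basic estimate ([fan], [fan_total]) concerns a set [K] that contains every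
given point of its convex hull.  Fix a blue point of [K] and join it to the red
points of [K]: consecutive red points, seen from there, span at least [r - 1]
triangles lying in disjoint wedges and free of red points, and each of the other
[b - 1] blue points of [K] spoils at most one of them.  So every blue point of
[K] is a vertex of at least [r - b] triangles of [E] inside [K], and [K] holds
at least [b * (r - b)] of them.  When [r] is about [2 * b] this is of order
[r ^ 2], and it adds up over disjoint sets [K].

It remains to find few such sets that cover many red points.  Let the degree of
a red point be the number of triangles of [E] at it; some red point [o] has
degree at most [2 * #|E| / n] ([low_degree_red]).  Some line through [o] has a
fixed fraction of the red points on each side ([tournament_balanced]), and since
there are at least as many blue points as red ones, one side has no more red
than blue points ([halving_side]).  Sort the points of that side by angle around
[o].  An interval [K] of this order is cut out by a wedge, so the estimate above
applies to it; and if it has both colours, two neighbours of different colours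
inside it form with [o] a triangle of [E] ([sector_corner]).

Cut the order into intervals with [r] close to [2 * b].  Each contains roughly
[r ^ 2 / 4] triangles of [E], and each uses up a triangle at [o], so that their
number is at most the degree of [o].  To balance the sizes against the number
of intervals, let [k] be about the square root of [n] and give the interval [K]
the potential

  [4 * #{t in E inside K} + (k ^ 2 + 4) * #{t in E with apex o over K}].

It is superadditive and, because [2 * k * r <= r ^ 2 + k ^ 2], at least
[2 * k * r] on a balanced interval ([potential_balanced]); hence it is at least
[k * r] on the whole side ([interval_potential]), where [r] is of order [n].  On
the other hand it is at most [4 * #|E| + (k ^ 2 + 4) * degree o], which is of
order [#|E|] because [k ^ 2 <= n] and [n * degree o <= 2 * #|E|].  So [#|E|] is
at least of order [k * n], that is of order [n ^ (3 / 2)]. *)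

Set Implicit Arguments.
Unset Strict Implicit.
Unset Printing Implicit Defensive.

Import Order.TTheory GRing.Theory Num.Theory.

Local Open Scope ring_scope.

(** * Sequences, tournaments and square roots *)

Lemma count_disjoint_leq (T : eqType) (a1 a2 a : pred T) (s : seq T) :
  {in s, forall x, a1 x -> a2 x -> False} ->
  {in s, forall x, a1 x -> a x} -> {in s, forall x, a2 x -> a x} ->
  (count a1 s + count a2 s <= count a s)%N.
Proof.
move=> dis sub1 sub2; rewrite -count_predUI addnC.
have /eqP -> : count (predI a1 a2) s == 0%N.
  rewrite -leqn0 leqNgt -has_count; apply/hasP => -[x xs /andP[]]; exact: dis.
have /eq_in_count-> : {in s, predU a1 a2 =1 predI (predU a1 a2) a}.
  move=> x xs /=; have := sub1 x xs; have := sub2 x xs.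
  by case: (a1 x) => /=; [move=> _ ->|case: (a2 x) => //= ->].
by apply: sub_count => x /andP[].
Qed.

Lemma color_change (T : Type) (c : pred T) (s : seq T) :
  has c s -> has (predC c) s ->
  exists s1 a b s2, s = s1 ++ a :: b :: s2 /\ c a != c b.
Proof.
elim: s => //= a [|b s] IHs; first by rewrite !orbF => ->.
have [ab|ab] := eqVneq (c a) (c b); last by exists [::], a, b, s.
rewrite ab /= !orbA !orbb => cs ncs.
have [s1 [a' [b' [s2 [-> ab']]]]] := IHs cs ncs.
by exists (a :: s1), a', b', s2.
Qed.

(** Let [r] and [b] be the numbers of elements that satisfy [c] (red) and that
do not (blue).  A sequence with [r <= 2 * b] is reduced to balanced pieces, on
which [f] is assumed to be large.  Reading from the left, close a piece as soon
as it satisfies [r < 2 * b]; the last step changed [2 * b] by [2], so the closed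
pieces are balanced.  They form a prefix [u], and the remainder [v] satisfies
[2 * b <= r].  If most of the red elements are in [v], the pieces are useless;
but then [v] can be extended to the left until it is balanced, because the whole
sequence satisfies [r <= 2 * b].  The factor [k] in the conclusion, against
[2 * k] in the hypothesis, pays for the choice between the two. *)
Lemma interval_potential (T : Type) (c : pred T) (Q : seq T -> Prop)
    (f : seq T -> nat) (k : nat) :
  (forall u v, Q (u ++ v) -> [/\ Q u, Q v & (f u + f v <= f (u ++ v))%N]) ->
  (forall s, Q s ->
    (count c s <= 2 * count (predC c) s)%N ->
    (2 * count (predC c) s <= count c s + 2)%N ->
    (2 * k * count c s <= f s)%N) ->
  forall s, Q s -> (count c s <= 2 * count (predC c) s)%N ->
    (k * count c s <= f s)%N.
Proof.
move=> Qcat Qbal s Qs rs.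
have [u [v [sE uvr fu]]] : exists u v, [/\ s = u ++ v,
    (2 * count (predC c) v <= count c v)%N & (2 * k * count c u <= f u)%N].
  elim/last_ind: s Qs {rs} => [_|s x IHs Qs].
    by exists [::], [::]; split => //=; lia.
  have [Qs' _ _] : [/\ Q s, Q [:: x] & (f s + f [:: x] <= f (s ++ [:: x]))%N].
    by apply: Qcat; rewrite cats1.
  have [u [v [sE uvr fu]]] := IHs Qs'.
  have [vx|vx] := leqP (2 * count (predC c) (rcons v x)) (count c (rcons v x)).
    by exists u, (rcons v x); rewrite sE rcons_cat.
  exists (u ++ rcons v x), [::]; rewrite cats0 -rcons_cat -sE; split=> //.
  move: Qs; rewrite sE rcons_cat => /Qcat[_ Qvx]; apply: leq_trans.
  rewrite count_cat mulnDr leq_add//; apply: Qbal => //; first exact: ltnW.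
  by move: vx; rewrite -cats1 !count_cat /=; case: (c x) => /=; lia.
have [y [z [uE r1 r2]]] : exists y z, [/\ u = y ++ z,
    (count c (z ++ v) <= 2 * count (predC c) (z ++ v))%N &
    (2 * count (predC c) (z ++ v) <= count c (z ++ v) + 2)%N].
  have ruv : (count c (u ++ v) <= 2 * count (predC c) (u ++ v))%N by rewrite -sE.
  elim: u ruv {sE fu} => [|x u IHu] ruv.
    by exists [::], [::]; split => //=; lia.
  have [ru|ru] := leqP (count c (u ++ v)) (2 * count (predC c) (u ++ v)).
    by have [y [z [-> r1 r2]]] := IHu ru; exists (x :: y), z.
  exists [::], (x :: u); split => //.
  by move: ruv ru => /=; case: (c x) => /=; lia.
have [_ _ fuv] := Qcat _ _ (eq_ind _ Q Qs _ sE).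
have [_ Qzv fyzv] : [/\ Q y, Q (z ++ v) & (f y + f (z ++ v) <= f s)%N].
  by rewrite sE uE -catA; apply: Qcat; rewrite catA -uE -sE.
have fzv := Qbal _ Qzv r1 r2.
move: fuv fzv; rewrite -sE {2}sE !count_cat; nia.
Qed.

(** The degrees of a tournament on [N] points add up to at least
[N * (N - 1) / 2]. *)
Lemma tournament_degree (T : eqType) (e : rel T) (A : seq T) (k : nat) :
  uniq A -> {in A &, forall x y, x != y -> e x y || e y x} ->
  {in A, forall x, count (e x) A <= k}%N -> (size A <= 2 * k + 1)%N.
Proof.
move=> uA tot deg.
have dbl : (\sum_(x <- A) (count (e x) A + count (e^~ x) A) =
    2 * \sum_(x <- A) count (e x) A)%N.
  rewrite big_split /= mul2n -addnn; congr (_ + _)%N.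
  under eq_bigr do rewrite -sum1_count big_mkcond.
  under [RHS]eq_bigr do rewrite -sum1_count big_mkcond.
  by rewrite exchange_big.
have low : (\sum_(x <- A) (size A).-1 <=
    \sum_(x <- A) (count (e x) A + count (e^~ x) A))%N.
  rewrite !big_seq; apply: leq_sum => x xA.
  rewrite -count_predUI; apply: leq_trans (leq_addr _ _).
  rewrite -(size_rem xA) rem_filter// -size_filter.
  apply: uniq_leq_size; first exact: filter_uniq.
  move=> y; rewrite !mem_filter /= => /andP[yx yA]; rewrite yA andbT.
  by rewrite tot // eq_sym.
have up : (\sum_(x <- A) count (e x) A <= \sum_(x <- A) k)%N.
  by rewrite !big_seq; apply: leq_sum.
move: low up; rewrite dbl !big_const_seq !iter_addn_0 !count_predT.
case: (size A) => //= N; nia.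
Qed.

(** By the previous lemma at most [2 * k + 1] elements have out-degree at most
[k], and as many have in-degree at most [k]. *)
Lemma tournament_balanced (T : eqType) (e : rel T) (s : seq T) (k : nat) :
  uniq s -> {in s &, forall x y, x != y -> e x y || e y x} ->
  (4 * k + 2 < size s)%N ->
  exists2 x, x \in s & (k < count (e x) s)%N && (k < count (e^~ x) s)%N.
Proof.
move=> us tot big; apply: contrapT => /forall2NP nox.
pose few (r : rel T) := [pred x | count (r x) s <= k]%N.
have few_le r : {in s &, forall x y, x != y -> r x y || r y x} ->
    (count (few r) s <= 2 * k + 1)%N.
  move=> tr; rewrite -size_filter; apply: (@tournament_degree _ r).
  - exact: filter_uniq.
  - by move=> x y; rewrite !mem_filter => /andP[_ xs] /andP[_ ys]; exact: tr.
  - move=> x; rewrite mem_filter => /andP[fx _]; apply: leq_trans fx.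
    by rewrite count_filter; apply: sub_count => y /andP[].
have c1 := few_le e tot.
have c2 := few_le (fun x y => e y x) (fun x y xs ys xy => tot _ _ ys xs
  (etrans (congr1 negb (eq_sym y x)) xy)).
have := count_predUI (few e) (few (fun x y => e y x)) s.
have -> : count (predU (few e) (few (fun x y => e y x))) s = size s.
  apply/eqP; rewrite -all_count; apply/allP => x xs /=.
  by case: (nox x) => // /negP; rewrite negb_and -!leqNgt.
lia.
Qed.

Lemma nat_sqrt n : exists k, (k ^ 2 <= n)%N /\ (n < k.+1 ^ 2)%N.
Proof.
elim: n => [|n [k [kn nk]]]; first by exists 0%N.
have [h|h] := leqP (k.+1 ^ 2) n.+1; last by exists k; split => //; exact: leqW.
by exists k.+1; split => //; nia.
Qed.

(** * Orientation and convex hulls in the plane *)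

Section Orientation.
Variable R : realType.
Implicit Types (a b c o p q w x y : 'rV[R]_2) (A K : set 'rV[R]_2).

Lemma row2P x y : x 0 0 = y 0 0 -> x 0 1 = y 0 1 -> x = y.
Proof.
move=> e0 e1; apply/rowP => -[[|[|//]] i].
- by rewrite (_ : Ordinal i = 0)//; apply/val_inj.
- by rewrite (_ : Ordinal i = 1)//; apply/val_inj.
Qed.

(** Twice the signed area of the triangle [a], [b], [c]. *)
Definition orient a b c : R :=
  (b 0 0 - a 0 0) * (c 0 1 - a 0 1) - (b 0 1 - a 0 1) * (c 0 0 - a 0 0).

Lemma orientC a b c : orient a c b = - orient a b c.
Proof. by rewrite /orient; ring. Qed.

Lemma orient_rot a b c : orient b c a = orient a b c.
Proof. by rewrite /orient; ring. Qed.

Lemma orient_abb a b : orient a b b = 0.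
Proof. by rewrite /orient; ring. Qed.

Lemma orient_aba a b : orient a b a = 0.
Proof. by rewrite /orient; ring. Qed.

(** The Plücker relation between the vectors from [o]. *)
Lemma orient_plucker o w a b c :
  orient o w b * orient o a c =
  orient o w a * orient o b c + orient o w c * orient o a b.
Proof. by rewrite /orient; ring. Qed.

(** The points [x] with [0 < orient o w x] form an open half-plane bounded by a
line through [o].  There the angular order around [o] does not wrap around. *)
Lemma orient_trans o w a b c :
  0 < orient o w a -> 0 < orient o w b -> 0 < orient o w c ->
  0 < orient o a b -> 0 < orient o b c -> 0 < orient o a c.
Proof.
move=> wa wb wc ab bc; rewrite -(pmulr_rgt0 _ wb) orient_plucker.
by rewrite addr_gt0// mulr_gt0.
Qed.

Lemma orient0_collinear a b c : a != b -> orient a b c = 0 ->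
  exists t : R, c = a + t *: (b - a).
Proof.
move=> ab /eqP; rewrite /orient subr_eq0 => /eqP abc.
have [u0|u0] := eqVneq (b 0 0 - a 0 0) 0.
  have v0 : b 0 1 - a 0 1 != 0.
    apply: contraNneq ab => /eqP; rewrite subr_eq0 => /eqP v0.
    by move/eqP: u0; rewrite subr_eq0 => /eqP u0; apply/eqP/row2P.
  exists ((c 0 1 - a 0 1) / (b 0 1 - a 0 1)).
  move: abc; rewrite u0 mul0r => /esym/eqP.
  rewrite mulf_eq0 (negbTE v0)/= subr_eq0 => /eqP ca.
  apply: row2P; rewrite !mxE; first by rewrite u0 mulr0 addr0.
  by rewrite divfK// addrC subrK.
exists ((c 0 0 - a 0 0) / (b 0 0 - a 0 0)).
apply: row2P; rewrite !mxE; first by rewrite divfK// addrC subrK.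
by rewrite mulrAC [X in X / _]mulrC -abc mulrAC mulfV// mul1r addrC subrK.
Qed.

Lemma general_position_orient (P : {fset 'rV[R]_2}) a b c :
  general_position P -> a \in P -> b \in P -> c \in P ->
  a != b -> a != c -> b != c -> orient a b c != 0.
Proof.
move=> gp aP bP cP ab ac bc; apply/eqP => abc.
apply: (gp [fset a; b; c]%fset).
- by apply/fsubsetP => x; rewrite !inE => /orP[/orP[]|] /eqP ->.
- by rewrite fsetUC cardfsU1 cardfs2 !inE ab eq_sym (negbTE ac) eq_sym (negbTE bc).
- have [t ct] := orient0_collinear ab abc.
  exists a, (b - a); split; first by rewrite subr_eq0 eq_sym.
  move=> x /=; rewrite !inE => /orP[/orP[]|] /eqP ->.
  + by exists 0; rewrite scale0r addr0.
  + by exists 1; rewrite scale1r addrC subrK.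
  + by exists t.
Qed.

Lemma hull_gen A : (A `<=` convex_hull A)%classic.
Proof. exact: sub_gen_smallest. Qed.

Lemma hull_mono A K : (A `<=` K -> convex_hull A `<=` convex_hull K)%classic.
Proof.
by move=> AK q Aq M [convM KM]; apply: Aq; split => // x /AK /KM.
Qed.

Lemma orient_conv a b x y (l : {i01 R}) :
  orient a b (conv l (x : convex_lmodType 'rV[R]_2) y) =
  l%:num * orient a b x + (1 - l%:num) * orient a b y.
Proof. by rewrite /orient /conv /= !mxE /onem; ring. Qed.

Lemma hull_orient_ge0 a b A q : (forall x, A x -> 0 <= orient a b x) ->
  convex_hull A q -> 0 <= orient a b q.
Proof.
move=> Aab /(_ [set x | 0 <= orient a b x]%classic); apply; split => // x y l.
rewrite !inE /= => xp yp; rewrite orient_conv.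
have l0 : 0 <= l%:num by [].
have l1 : l%:num <= 1 by [].
by rewrite addr_ge0 ?mulr_ge0// subr_ge0.
Qed.

Lemma hull_orient_gt0 a b A q : (forall x, A x -> 0 < orient a b x) ->
  convex_hull A q -> 0 < orient a b q.
Proof.
move=> Aab /(_ [set x | 0 < orient a b x]%classic); apply; split => // x y l.
rewrite !inE /= => xp yp; rewrite orient_conv.
have l0 : 0 <= l%:num by [].
have l1 : l%:num <= 1 by [].
have [->|l_neq0] := eqVneq l%:num 0; first by rewrite mul0r add0r subr0 mul1r.
apply: ltr_wpDr; first by apply: mulr_ge0; [rewrite subr_ge0|exact: ltW].
by rewrite mulr_gt0// lt_def l_neq0.
Qed.

(** Counterclockwise order around [o]; it is a strict order only on half-planes
bounded by a line through [o]. *)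
Definition ccw o : rel 'rV[R]_2 := fun x y => 0 < orient o x y.

Lemma angular_sort o w (s : seq 'rV[R]_2) : uniq s ->
  {in s, forall x, 0 < orient o w x} ->
  {in s &, forall x y, x != y -> orient o x y != 0} ->
  exists2 s', perm_eq s' s & pairwise (ccw o) s'.
Proof.
move=> us sw s0; pose le x y := 0 <= orient o x y.
have le_tr : {in s & &, transitive le}.
  move=> b a c bs as_ cs ab bc; rewrite /le -(pmulr_rge0 _ (sw b bs)).
  by rewrite orient_plucker addr_ge0// mulr_ge0// ltW// sw.
have le_tot : total le.
  by move=> x y; rewrite /le (orientC o x y) oppr_ge0 orbC; exact: le_total.
exists (sort le s); first by rewrite perm_sort.
have all_s : all (mem s) (sort le s) by apply/allP => x; rewrite mem_sort.
have := sort_sorted le_tot s; rewrite (sorted_pairwise_in le_tr all_s) => pw.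
have : uniq (sort le s) by rewrite sort_uniq.
rewrite uniq_pairwise => pu.
have : pairwise [rel x y | le x y && (x != y)] (sort le s).
  by rewrite pairwise_relI pw.
apply: (sub_in_pairwise (P := mem s)) => //.
move=> x y xs ys /andP[xy nxy]; rewrite /ccw lt_def (s0 _ _ xs ys nxy).
exact: xy.
Qed.

Lemma ccw_asym o x y : ccw o x y -> ~~ ccw o y x.
Proof. by rewrite /ccw orientC oppr_gt0 -leNgt => /ltW. Qed.

Lemma ccw_total o x y : orient o x y != 0 -> ccw o x y || ccw o y x.
Proof. by rewrite /ccw (orientC o x y) oppr_gt0 orbC neq_lt. Qed.

End Orientation.

(** * Empty triangles at a blue point *)

Section Fan.
Variable R : realType.
Variables Rd Bl : {fset 'rV[R]_2}.
Hypothesis dis : [disjoint Rd & Bl]%fset.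
Hypothesis gp : general_position (Rd `|` Bl)%fset.
Implicit Types (a b c o p q w x y : 'rV[R]_2) (K : seq 'rV[R]_2).

Local Notation P := (Rd `|` Bl)%fset.
Local Notation E := (empty_red_red_blue_triangles Rd Bl).
Local Notation red := (mem Rd).
Local Notation blue := (predC (mem Rd)).

Lemma blueP x : x \in P -> (x \in Bl) = (x \notin Rd).
Proof.
rewrite inE; case: (boolP (x \in Rd)) => //= xR _.
by apply/negbTE; exact: (fdisjointP dis).
Qed.

(** In general position no given point lies on a side line of the triangle, so
the weak inequalities that hold on the hull become strict. *)
Lemma hull_triangle a b c x : 0 < orient a b c ->
  a \in P -> b \in P -> c \in P -> x \in P -> x \notin [fset a; b; c]%fset ->
  convex_hull [set` [fset a; b; c]%fset] x ->
  [/\ ccw a b x, ccw b c x & ccw c a x].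
Proof.
move=> abc aP bP cP xP; rewrite !inE !negb_or !(eq_sym x) => /andP[/andP[ax bx] cx] hx.
have distinct u v : orient u u v = 0.
  by rewrite -[LHS]orient_rot orient_aba.
have ab : a != b by apply: contraTneq abc => ->; rewrite distinct ltxx.
have ca : c != a by apply: contraTneq abc => ->; rewrite orient_aba ltxx.
have bc : b != c by apply: contraTneq abc => ->; rewrite orient_abb ltxx.
have side u v : u \in P -> v \in P -> u != v -> u != x -> v != x ->
    0 <= orient u v a -> 0 <= orient u v b -> 0 <= orient u v c -> ccw u v x.
  move=> uP vP uv xu xv ua ub uc; rewrite /ccw lt_def.
  rewrite (general_position_orient gp)//=.
  apply: hull_orient_ge0 hx => y /=.
  by rewrite !inE => /orP[/orP[]|] /eqP ->.
have bca : orient b c a = orient a b c by exact: orient_rot.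
have cab : orient c a b = orient a b c by rewrite 2!orient_rot.
by split; apply: side; rewrite // ?orient_aba ?orient_abb ?bca ?cab ?lexx ?ltW//.
Qed.

Lemma red_red_blue_triangleP p q b :
  p \in Rd -> q \in Rd -> b \in P -> b \notin Rd -> p != q ->
  (forall x, x \in P -> convex_hull [set` [fset p; q; b]%fset] x ->
             x \in [fset p; q; b]%fset) ->
  [fset p; q; b]%fset \in E.
Proof.
move=> pR qR bP bR pq emp.
have bB : b \in Bl by rewrite blueP.
have pB : p \notin Bl by rewrite blueP ?inE pR.
have qB : q \notin Bl by rewrite blueP ?inE qR.
have pb : p != b by apply: contraNneq bR => <-.
have qb : q != b by apply: contraNneq bR => <-.
have sub : ([fset p; q; b] `<=` P)%fset.
  apply/fsubsetP => x; rewrite !inE => /orP[/orP[]|] /eqP ->.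
  - by rewrite pR.
  - by rewrite qR.
  - by rewrite bB orbT.
rewrite !inE /= fpowersetE sub /=; apply/asboolP; split; split => //.
- by rewrite fsetUC cardfsU1 cardfs2 !inE pq eq_sym (negbTE pb) eq_sym (negbTE qb).
- apply/seteqP; split => [x /= [hx xP]|x /= xt]; first exact: emp.
  by split; [exact: hull_gen|exact: (fsubsetP sub)].
- rewrite (_ : _ `&` _ = [fset p; q])%fset ?cardfs2 ?pq//.
  apply/fsetP => x; rewrite !inE.
  have [->|xp] := eqVneq x p; first by rewrite pR.
  have [->|xq] := eqVneq x q; first by rewrite qR.
  by have [->|xb] := eqVneq x b; rewrite ?(negbTE bR).
- rewrite (_ : _ `&` _ = [fset b])%fset ?cardfs1//.
  apply/fsetP => x; rewrite !inE.
  have [->|xb] := eqVneq x b; first by rewrite bB orbT.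
  rewrite orbF; have [->|xp] := eqVneq x p; first by rewrite (negbTE pB).
  by have [->|xq] := eqVneq x q; rewrite ?(negbTE qB).
Qed.

(** Emptiness among the points of such a set is the same as emptiness among all
the points. *)
Definition hull_closed K :=
  forall x, x \in P -> convex_hull [set` K] x -> x \in K.

(** The neighbour of [p] in the counterclockwise sense, as seen from [b], exists
as soon as some point is within half a turn of [p]. *)
Lemma next_ccw b p (S : seq 'rV[R]_2) : uniq S -> {subset S <= P} -> b \in P ->
  b \notin S -> has (ccw b p) S ->
  exists2 q, q \in S /\ ccw b p q &
    {in S, forall x, ccw b p x -> x = q \/ ccw b q x}.
Proof.
move=> uS SP bP bS /hasP[x0 x0S px0].
have [|x|x y|s' ss' ps'] := @angular_sort _ b p (filter (ccw b p) S).
- exact: filter_uniq.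
- by rewrite mem_filter => /andP[].
- rewrite !mem_filter => /andP[_ xS] /andP[_ yS] xy.
  apply: (general_position_orient gp) => //; try exact: SP.
  + by apply: contraNneq bS => ->.
  + by apply: contraNneq bS => ->.
have in_s' x : (x \in s') = ccw b p x && (x \in S).
  by rewrite (perm_mem ss') mem_filter.
case: s' {ss'} ps' in_s' => [|q s'] /= ps' in_s'.
  by have := in_s' x0; rewrite px0 x0S.
exists q; first by have := in_s' q; rewrite mem_head => /esym/andP[].
move=> x xS px; have := in_s' x; rewrite px xS inE => /orP[/eqP|xs']; first by left.
by right; case/andP: ps' => /allP/(_ x xs').
Qed.

Definition spanned K (t : {fset 'rV[R]_2}) := all (mem K) t.

(** Each red point [p] of [K] is either followed, as seen from [b], by a red
point [nxt p] such that the triangle on [b], [p], [nxt p] is empty, or it is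
charged to a blue point of [K].  The charged point is one in the wedge between
[p] and [nxt p], or [b] itself if no red point follows [p] within half a turn,
which happens for at most one [p].  The wedges are disjoint, so no blue point
is charged twice. *)
Lemma fan K b : uniq K -> {subset K <= P} -> hull_closed K ->
  b \in K -> b \notin Rd ->
  (count red K <= count blue K + count (fun t => spanned K t && (b \in t)) E)%N.
Proof.
move=> uK KP cK bK bR; set F := fun t => _; pose S := filter red K.
have uS : uniq S by exact: filter_uniq.
have memS x : (x \in S) = (x \in Rd) && (x \in K) by rewrite mem_filter.
have SR x : x \in S -> x \in Rd by rewrite memS => /andP[].
have SK x : x \in S -> x \in K by rewrite memS => /andP[].
have SP : {subset S <= P} by move=> x /SK /KP.
have bP := KP _ bK.
have bS : b \notin S by rewrite memS (negbTE bR).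
have Sb x : x \in S -> x != b by apply: contraTneq => ->.
(* The successor of [p] would be at an angle of at least half a turn. *)
pose last p := ~~ has (ccw b p) S.
have /choice[nxt nxtP] : forall p, exists q, p \in S -> ~~ last p ->
    [/\ q \in S, ccw b p q & {in S, forall x, ccw b p x -> x = q \/ ccw b q x}].
  move=> p; case: (boolP (last p)) => [_|]; first by exists p.
  by rewrite negbK => /(next_ccw uS SP bP bS)[q [? ?] ?]; exists q.
pose tau p := [fset p; nxt p; b]%fset.
pose good p := ~~ last p && (tau p \in E).
have /choice[obs obsP] : forall p, exists u, p \in S -> ~~ good p ->
    [/\ u \in K, u \notin Rd & if last p then u = b
      else [/\ u != b, ccw b p u & ccw b u (nxt p)]].
  move=> p; case: (boolP (p \in S)) => pS; last by exists p.
  rewrite /good; case: (boolP (last p)) => [_|lp] /=; first by exists b.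
  have [nS pn nmin] := nxtP p pS lp.
  apply: contrapT => /forallNP noobs.
  have pn' : p != nxt p.
    by apply: contraTneq pn => <-; rewrite /ccw orient_abb ltxx.
  have := noobs p; apply => _ /negP[]; apply: red_red_blue_triangleP => //.
  - exact: SR.
  - exact: SR.
  move=> x xP hx; apply: contrapT => /negP xt.
  have xK : x \in K.
    apply: cK => //; apply: hull_mono hx => y /=.
    rewrite !inE => /orP[/orP[]|] /eqP -> //;
      exact: SK.
  have [|||||_ nbx bpx] := hull_triangle _ _ _ _ _ xt hx => //; try exact: SP.
    by rewrite orient_rot.
  have bxn : ccw b x (nxt p) by rewrite /ccw orient_rot.
  case: (boolP (x \in Rd)) => xR.
    have xS : x \in S by rewrite memS xR.
    case: (nmin x xS bpx) => [xn|]; first by move: xt; rewrite xn !inE eqxx orbT.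
    by apply/negP; exact: ccw_asym.
  apply: (noobs x) => _ _; split=> //; split => //.
  by move: xt; rewrite !inE !negb_or => /andP[].
have tot x y : x \in S -> y \in S -> x != y -> ccw b x y \/ ccw b y x.
  move=> xS yS xy; apply/orP/ccw_total/(general_position_orient gp) => //;
    by rewrite ?SP// eq_sym Sb.
have obs_inj : {in filter (predC good) S &, injective obs}.
  have wlog_inj p q : p \in S -> q \in S -> ~~ good p -> ~~ good q ->
      ccw b p q -> obs p != obs q.
    move=> pS qS ngp gq pq; have [_ _ op] := obsP p pS ngp.
    have [_ _ oq] := obsP q qS gq.
    case: (boolP (last p)) op => [/hasPn/(_ q qS)|lp]; first by rewrite pq.
    move=> [ub pu un]; case: (boolP (last q)) oq => [_ ->//|lq [_ qu _]].
    apply/eqP => opq; rewrite -opq in qu.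
    have [nS pn nmin] := nxtP p pS lp.
    have qn : ccw b q (nxt p) by exact: (@orient_trans _ b p q (obs p)).
    case: (nmin q qS pq) => [qE|nq].
      by move: qn; rewrite -qE /ccw orient_abb ltxx.
    by move: qn; apply/negP; exact: ccw_asym.
  move=> p q; rewrite mem_filter => /andP[/= ngp pS].
  rewrite mem_filter => /andP[/= gq qS] opq.
  apply/eqP; apply: contraTT isT => pq.
  by case: (tot p q pS qS pq) => /wlog_inj; rewrite opq eqxx; apply.
have tau_inj : {in filter good S &, injective tau}.
  move=> p q; rewrite mem_filter => /andP[/andP[lp _] pS].
  rewrite mem_filter => /andP[/andP[lq _] qS] e.
  have [_ pn _] := nxtP p pS lp; have [_ qn _] := nxtP q qS lq.
  have : p \in tau q by rewrite -e !inE eqxx.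
  have : q \in tau p by rewrite e !inE eqxx.
  rewrite !inE (negbTE (Sb _ pS)) (negbTE (Sb _ qS)) !orbF.
  case/predU1P => [->//|/eqP qE]; case/predU1P => [->//|/eqP pE].
  move: pn; rewrite -qE {1}pE => /ccw_asym; rewrite -pE.
  by move: qn; rewrite -pE => ->.
rewrite -size_filter -/S -(count_predC good) addnC -!size_filter; apply: leq_add.
- rewrite -(size_map obs); apply: uniq_leq_size.
    by rewrite map_inj_in_uniq ?filter_uniq.
  move=> _ /mapP[p + ->]; rewrite mem_filter => /andP[/= ngp pS]; rewrite mem_filter /=.
  by have [uK' uR _] := obsP p pS ngp; rewrite uR.
- rewrite -(size_map tau); apply: uniq_leq_size.
    by rewrite map_inj_in_uniq ?filter_uniq.
  move=> _ /mapP[p + ->]; rewrite mem_filter => /andP[/andP[lp tE] pS].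
  rewrite mem_filter.
  rewrite tE andbT /F !inE eqxx orbT andbT; apply/allP => x.
  have [nS _ _] := nxtP p pS lp.
  rewrite !inE => /orP[/orP[]|] /eqP -> //=;
    exact: SK.
Qed.

Lemma mem_triangles t : t \in E ->
  [/\ (t `<=` P)%fset, #|` (t `&` Rd)%fset| = 2%N & #|` (t `&` Bl)%fset| = 1%N].
Proof. by rewrite !inE /= => /andP[_ /asboolP[[? _ _] [? ?]]]. Qed.

(** Summing [fan] over the blue points of [K] does not count a triangle twice,
since a triangle has a single blue vertex. *)
Lemma fan_total K : uniq K -> {subset K <= P} -> hull_closed K ->
  (count blue K * (count red K - count blue K) <= count (spanned K) E)%N.
Proof.
move=> uK KP cK; set d := (_ - _)%N.
have le_d : (count blue K * d <=
    \sum_(b <- K | blue b) count (fun t => spanned K t && (b \in t)) E)%N.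
  rewrite -sum1_count big_distrl /= big_seq_cond [X in (_ <= X)%N]big_seq_cond.
  apply: leq_sum => b /andP[bK bR]; rewrite mul1n leq_subLR; exact: fan.
apply: (leq_trans le_d).
under eq_bigr do rewrite -sum1_count big_mkcondr.
rewrite exchange_big -sum1_count /=.
rewrite big_seq_cond [X in (_ <= X)%N]big_seq_cond.
apply: leq_sum => t /andP[/mem_triangles[tP _ tB] _].
rewrite -big_mkcondr sum1_count -[X in (_ <= X)%N]tB -size_filter.
apply: uniq_leq_size; first exact: filter_uniq.
move=> x; rewrite mem_filter => /andP[/andP[xR xt] _].
by rewrite inE xt blueP ?(fsubsetP tP).
Qed.

(** * Angular sectors at a red point *)

Definition degree o := count (fun t : {fset 'rV[R]_2} => o \in t) E.

Section Sectors.
Variables (o w : 'rV[R]_2).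
Hypothesis oR : o \in Rd.

(** The given points of a wedge with apex [o] inside the open half-plane to the
left of the line from [o] to [w], listed by angle.  Letting [w] range over
the whole plane gives every such half-plane. *)
Definition sector K :=
  [/\ pairwise (ccw o) K, {subset K <= P}, {in K, forall x, ccw o w x} &
      forall a b x, a \in K -> b \in K -> x \in P -> ccw o w x ->
        0 <= orient o a x -> 0 <= orient o x b -> x \in K].

Lemma sector_uniq K : sector K -> uniq K.
Proof.
by case=> pK _ _ _; apply: pairwise_uniq pK => x; rewrite /ccw orient_abb ltxx.
Qed.

Lemma sector_cat K1 K2 : sector (K1 ++ K2) -> sector K1 /\ sector K2.
Proof.
case; rewrite pairwise_cat => /and3P[/allrelP K12 pK1 pK2] KP Kw Kint.
have in1 x : x \in K1 -> x \in K1 ++ K2 by rewrite mem_cat => ->.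
have in2 x : x \in K2 -> x \in K1 ++ K2 by rewrite mem_cat orbC => ->.
split; split => //.
- by move=> x /in1 /KP.
- by move=> x /in1 /Kw.
- move=> a b x a1 b1 xP xw ax xb.
  have := Kint a b x (in1 _ a1) (in1 _ b1) xP xw ax xb.
  rewrite mem_cat => /orP[//|/(K12 _ _ b1)].
  by rewrite /ccw orientC oppr_gt0 ltNge xb.
- by move=> x /in2 /KP.
- by move=> x /in2 /Kw.
- move=> a b x a2 b2 xP xw ax xb.
  have := Kint a b x (in2 _ a2) (in2 _ b2) xP xw ax xb.
  rewrite mem_cat => /orP[x1|//]; have := K12 _ _ x1 a2.
  by rewrite /ccw orientC oppr_gt0 ltNge ax.
Qed.

(** A point of the hull cannot be strictly before, or strictly after, all the
points of [K] in the angular order, since half-planes are convex. *)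
Lemma sector_closed K : sector K -> hull_closed K.
Proof.
case=> _ _ Kw Kint x xP hx.
have xw : ccw o w x by exact: hull_orient_gt0 hx.
have [a aK ax] : exists2 a, a \in K & 0 <= orient o a x.
  apply: contrapT => /forall2NP noa.
  suff : 0 < orient o x x by rewrite orient_abb ltxx.
  apply: hull_orient_gt0 hx => y yK; rewrite orientC oppr_gt0 ltNge.
  by apply/negP; case: (noa y).
have [b bK xb] : exists2 b, b \in K & 0 <= orient o x b.
  apply: contrapT => /forall2NP nob.
  suff : 0 < orient x o x by rewrite orient_aba ltxx.
  apply: hull_orient_gt0 hx => y yK.
  rewrite -[X in 0 < X]orient_rot orientC oppr_gt0 ltNge.
  by apply/negP; case: (nob y).
exact: Kint ax xb.
Qed.

Lemma sector_full :
  exists2 K, sector K & forall x, (x \in K) = (x \in P) && ccw o w x.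
Proof.
pose s := [seq x <- P | ccw o w x].
have ms x : (x \in s) = (x \in P) && ccw o w x by rewrite mem_filter andbC.
have so x : x \in s -> x != o.
  by rewrite ms => /andP[_]; apply: contraTneq => ->; rewrite /ccw orient_aba ltxx.
have oP : o \in P by rewrite inE oR.
have [||x y xs ys xy|K Ks pK] := @angular_sort _ o w s.
- exact/filter_uniq/fset_uniq.
- by move=> x; rewrite ms => /andP[].
- move: xs ys (so _ xs) (so _ ys); rewrite !ms => /andP[xP _] /andP[yP _] xo yo.
  by apply: (general_position_orient gp); rewrite // eq_sym.
exists K => [|x]; last by rewrite (perm_mem Ks) ms.
split=> //.
- by move=> x; rewrite (perm_mem Ks) ms => /andP[].
- by move=> x; rewrite (perm_mem Ks) ms => /andP[].
- by move=> a b x _ _ xP xw _ _; rewrite (perm_mem Ks) ms xP.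
Qed.

(** The triangles at [o] whose other two vertices are in [K]. *)
Definition corners K :=
  count (fun t : {fset 'rV[R]_2} => (o \in t) && spanned (o :: K) t) E.

(** A triangle with apex [o] over two consecutive points of [K] is empty: a
given point in it would be between them in the angular order. *)
Lemma sector_corner K : sector K -> has red K -> has blue K -> (0 < corners K)%N.
Proof.
move=> sK rK bK; have [K1 [a [b [K2 [KE ab]]]]] := color_change rK bK.
have oP : o \in P by rewrite inE oR.
case: (sK) => pK KP Kw Kint.
have aK : a \in K by rewrite KE mem_cat mem_head orbT.
have bK' : b \in K by rewrite KE mem_cat !inE eqxx !orbT.
have ko x : x \in K -> o != x.
  by move=> /Kw; apply: contraTneq => <-; rewrite /ccw orient_aba ltxx.
move: pK; rewrite {1}KE pairwise_cat /= => /and3P[/allrelP K12 _].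
move=> /and3P[/andP[ab' _] /allP bK2 _].
have empty x : x \in P ->
    convex_hull [set` [fset o; a; b]%fset] x -> x \in [fset o; a; b]%fset.
  move=> xP hx; apply: contrapT => /negP xt.
  have [ox _ xo] := hull_triangle ab' oP (KP _ aK) (KP _ bK') xP xt hx.
  have xb : ccw o x b by rewrite /ccw orient_rot.
  have xw : ccw o w x.
    rewrite /ccw -(pmulr_lgt0 _ ab') orient_plucker.
    by rewrite addr_gt0// mulr_gt0//; exact: Kw.
  have := Kint a b x aK bK' xP xw (ltW ox) (ltW xb).
  move: xt; rewrite KE mem_cat !inE !negb_or => /andP[/andP[_ /negbTE->] /negbTE->] /=.
  case/orP => [x1|/bK2]; last by apply/negP/ccw_asym.
  have := K12 x a x1 (mem_head _ _); by apply/negP/ccw_asym.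
rewrite /corners -has_count; apply/hasP; exists [fset o; a; b]%fset; last first.
  rewrite !inE eqxx /=; apply/allP => x.
  by rewrite !inE => /orP[/orP[]|] /eqP ->; rewrite /= ?inE ?eqxx ?aK ?bK' ?orbT.
have [aR|aR] := boolP (a \in Rd).
  apply: red_red_blue_triangleP => //; rewrite ?KP ?ko//.
  by move: ab; rewrite /= aR; case: (b \in Rd).
have bR : b \in Rd by move: ab; rewrite /= (negbTE aR); case: (b \in Rd).
have -> : [fset o; a; b]%fset = [fset o; b; a]%fset.
  by apply/fsetP => x; rewrite !inE orbAC.
apply: red_red_blue_triangleP => //; rewrite ?KP ?ko// => x xP.
have -> : [fset o; b; a]%fset = [fset o; a; b]%fset.
  by apply/fsetP => y; rewrite !inE orbAC.
exact: empty.
Qed.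


(** The weight [k ^ 2] on the corners turns, through [r ^ 2 + k ^ 2 >= 2 * k * r],
a quadratic estimate on each interval into one that is linear in [r] and can be
summed.  The additional [4] absorbs the rounding when [r] differs from
[2 * b]. *)
Definition potential k K :=
  (4 * count (spanned K) E + (k ^ 2 + 4) * corners K)%N.

(** No triangle is counted on both sides: it has a red vertex, and even one other
than [o], because it has two. *)
Lemma potential_cat k K1 K2 : sector (K1 ++ K2) ->
  (potential k K1 + potential k K2 <= potential k (K1 ++ K2))%N.
Proof.
move=> sK; have := sector_uniq sK; rewrite cat_uniq => /and3P[_ K12 _].
have disj x : x \in K1 -> x \in K2 -> False.
  by move=> x1 x2; case/hasP: K12; exists x.
have spl : (count (spanned K1) E + count (spanned K2) E <=
    count (spanned (K1 ++ K2)) E)%N.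
  apply: count_disjoint_leq => t tE s1 => [s2||].
  - have [_ tR _] := mem_triangles tE.
    have /fset0Pn[x] : (t `&` Rd)%fset != fset0 by rewrite -cardfs_gt0 tR.
    rewrite inE => /andP[xt _].
    by apply: (disj x); [exact: (allP s1)|exact: (allP s2)].
  - by apply/allP => x /(allP s1) /=; rewrite mem_cat => ->.
  - by apply/allP => x /(allP s1) /=; rewrite mem_cat orbC => ->.
have spc : (corners K1 + corners K2 <= corners (K1 ++ K2))%N.
  apply: count_disjoint_leq => t tE /andP[ot s1] => [/andP[_ s2]||].
  - have [_ tR _] := mem_triangles tE.
    have : (0 < #|` (t `&` Rd) `\ o|)%fset%N.
      by move: tR; rewrite (cardfsD1 o) inE ot oR; lia.
    rewrite cardfs_gt0 => /fset0Pn[x]; rewrite !inE => /andP[xo /andP[xt _]].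
    move: (allP s1 x xt) (allP s2 x xt); rewrite /= !inE (negbTE xo) /=.
    exact: disj.
  - rewrite ot; apply/allP => x /(allP s1); rewrite /= !inE mem_cat.
    by case/orP => ->; rewrite ?orbT.
  - rewrite ot; apply/allP => x /(allP s1); rewrite /= !inE mem_cat.
    by case/orP => ->; rewrite ?orbT.
rewrite /potential addnACA -!mulnDr leq_add// leq_mul2l; first by rewrite spl.
by rewrite spc orbT.
Qed.

(** A balanced sector holds at least [b * (r - b)] triangles, which is at least
[(r ^ 2 - 4) / 4], and at least one corner as soon as it has a red point. *)
Lemma potential_balanced k K : sector K ->
  (count red K <= 2 * count blue K)%N ->
  (2 * count blue K <= count red K + 2)%N ->
  (2 * k * count red K <= potential k K)%N.
Proof.
move=> sK rb br; case: (sK) => _ KP _ _.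
have := fan_total (sector_uniq sK) KP (sector_closed sK).
have [->|r0] := posnP (count red K); first by rewrite muln0.
have : (0 < corners K)%N.
  by apply: sector_corner => //; rewrite has_count //; lia.
rewrite /potential; set r := count red K in rb br r0 *.
set b := count blue K in rb br *; set F := count _ E; set g := corners K.
move=> g0 fF; have gk : (k ^ 2 + 4 <= (k ^ 2 + 4) * g)%N by rewrite leq_pmulr.
have rF : (r ^ 2 <= 4 * F + 4)%N.
  suff : (r ^ 2 <= 4 * (b * (r - b)) + 4)%N by lia.
  have [e|[e|e]] : r = (2 * b)%N \/ r = (2 * b - 1)%N \/ r = (2 * b - 2)%N by lia.
  - rewrite e (_ : 2 * b - b = b)%N; last by lia.
    nia.
  - rewrite e (_ : 2 * b - 1 - b = b - 1)%N; last by lia.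
    nia.
  - rewrite e (_ : 2 * b - 2 - b = b - 2)%N; last by lia.
    nia.
have : (2 * (k * r) <= k ^ 2 + r ^ 2)%N by exact: nat_Cauchy.
lia.
Qed.

Lemma sector_bound k :
  let ccw_red := count (ccw o w) Rd in
  (ccw_red <= 2 * count (ccw o w) Bl)%N ->
  (k * ccw_red <= 4 * #|` E| + (k ^ 2 + 4) * degree o)%N.
Proof.
move=> /= rb; have [K sK memK] := sector_full.
have cR : count red K = count (ccw o w) Rd.
  rewrite -!size_filter; apply/perm_size/uniq_perm.
  - exact/filter_uniq/(sector_uniq sK).
  - exact/filter_uniq/fset_uniq.
  - move=> x; rewrite !mem_filter memK in_fsetU /=.
    by case: (x \in Rd); rewrite /= ?andbT ?andbF.
have cB : count blue K = count (ccw o w) Bl.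
  rewrite -!size_filter; apply/perm_size/uniq_perm.
  - exact/filter_uniq/(sector_uniq sK).
  - exact/filter_uniq/fset_uniq.
  - move=> x; rewrite !mem_filter memK /= andbA andbC; congr (_ && _).
    case: (boolP (x \in P)) => [/blueP->|]; first by rewrite andbT.
    by rewrite inE negb_or andbF => /andP[_ /negbTE].
have := @interval_potential _ red sector (potential k) k _ _ K sK.
rewrite cR cB => h; apply: leq_trans (h _ _ rb) _.
- by move=> u v uv; have [? ?] := sector_cat uv; split => //; exact: potential_cat.
- exact: potential_balanced.
rewrite /potential leq_add// leq_mul2l ?count_size// ?orbF.
by apply/orP; right; apply: sub_count => t /andP[].
Qed.

End Sectors.

(** * Counting all triangles *)

Lemma reflected_side o p q : orient o (2 *: o - p) q = orient o q p.
Proof. by rewrite /orient !mxE; ring. Qed.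

(** For a fixed [o], the relation [ccw o] is a tournament on the other red
points.  A red point [p] with large out- and in-degree gives a line through [o]
and [p] with many red points on both sides.  This line contains no blue point,
so one side has at least as many blue points as red ones. *)
Lemma halving_side o : o \in Rd -> (4 <= #|` Rd|)%N -> (#|` Rd| <= #|` Bl|)%N ->
  exists w, (#|` Rd| <= 8 * count (ccw o w) Rd)%N /\
            (count (ccw o w) Rd <= 2 * count (ccw o w) Bl)%N.
Proof.
move=> oR n4 nm; pose s : seq 'rV[R]_2 := (Rd `\ o)%fset.
have ms x : (x \in s) = (x != o) && (x \in Rd) by rewrite in_fsetD1.
have sz : (size s).+1 = #|` Rd| by rewrite (cardfsD1 o) oR.
have RP x : x \in Rd -> x \in P by rewrite inE => ->.
have BP x : x \in Bl -> x \in P by rewrite inE orbC => ->.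
have [|x y||p ps /andP[lp rp]] :=
    @tournament_balanced _ (ccw o) s (#|` Rd| %/ 4 - 1).
- exact: fset_uniq.
- rewrite !ms => /andP[xo xR] /andP[yo yR] xy; apply/ccw_total.
  by apply: (general_position_orient gp); rewrite ?RP // eq_sym.
- by rewrite -ltnS sz; lia.
have [po pR] := andP (etrans (esym (ms p)) ps).
have sR (a : pred 'rV[R]_2) : (count a s <= count a Rd)%N.
  rewrite -!size_filter; apply: uniq_leq_size; first exact/filter_uniq/fset_uniq.
  by move=> x; rewrite !mem_filter ms => /andP[-> /andP[_ ->]].
have Rle : (count (ccw o p) Rd + count (ccw o ^~ p) Rd <= #|` Rd|)%N.
  rewrite -count_predUI (_ : count (predI _ _) _ = 0)%N ?addn0 ?count_size//.
  apply/eqP; rewrite -leqn0 leqNgt -has_count; apply/hasP => -[x _ /andP[]].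
  by move=> /ccw_asym/negbTE ->.
have Bge : (#|` Bl| <= count (ccw o p) Bl + count (ccw o ^~ p) Bl)%N.
  rewrite -count_predUI; apply: leq_trans (leq_addr _ _).
  rewrite -count_predT; apply/eq_leq/eq_in_count => x xB /=; symmetry.
  have xR : x \notin Rd by rewrite -blueP ?BP.
  apply/ccw_total/(general_position_orient gp).
  - exact: RP.
  - exact: RP.
  - exact: BP.
  - by rewrite eq_sym.
  - by apply: contraNneq xR => <-.
  - by apply: contraNneq xR => <-.
have refl (A : seq 'rV[R]_2) :
    count (ccw o (2 *: o - p)) A = count (ccw o ^~ p) A.
  by apply: eq_count => x; rewrite /ccw reflected_side.
have lpR : (#|` Rd| %/ 4 - 1 < count (ccw o p) Rd)%N by exact: leq_trans lp (sR _).
have rpR : (#|` Rd| %/ 4 - 1 < count (ccw o ^~ p) Rd)%N by exact: leq_trans rp (sR _).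
(* The right side of the line is the left side for the reflection of [p]. *)
have [bp|bp] := leqP (count (ccw o p) Rd) (count (ccw o p) Bl).
  by exists p; split; lia.
by exists (2 *: o - p); rewrite !refl; split; lia.
Qed.

Lemma apex_bound o k : o \in Rd -> (4 <= #|` Rd|)%N -> (#|` Rd| <= #|` Bl|)%N ->
  (k * #|` Rd| <= 8 * (4 * #|` E| + (k ^ 2 + 4) * degree o))%N.
Proof.
move=> oR n4 nm; have [w [nw bw]] := halving_side oR n4 nm.
have := sector_bound oR k bw.
by move: nw; set r := count _ _; nia.
Qed.

(** The degrees of the red points add up to twice the number of triangles. *)
Lemma low_degree_red : (0 < #|` Rd|)%N ->
  exists2 o, o \in Rd & (#|` Rd| * degree o <= 2 * #|` E|)%N.
Proof.
move=> n0; apply: contrapT => /forall2NP high.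
have tot : (\sum_(o <- Rd) degree o = 2 * #|` E|)%N.
  rewrite /degree; under eq_bigr do rewrite -sum1_count big_mkcond.
  rewrite exchange_big /= big_seq.
  under eq_bigr => t tE.
    rewrite -big_mkcond sum1_count.
    have -> : count (mem t) Rd = 2%N.
      have [_ tR _] := mem_triangles tE; rewrite -[RHS]tR -size_filter.
      apply/perm_size/uniq_perm; rewrite ?filter_uniq ?fset_uniq//.
      by move=> x; rewrite mem_filter in_fsetI.
    over.
  by rewrite -big_seq big_const_seq iter_addn_0 count_predT.
have : (\sum_(o <- Rd) (2 * #|` E|).+1 <= \sum_(o <- Rd) #|` Rd| * degree o)%N.
  rewrite !big_seq; apply: leq_sum => o oR; rewrite ltnNge; apply/negP.
  by case: (high o).
rewrite -big_distrr /= tot big_const_seq iter_addn_0 count_predT mulnC leq_pmul2l//.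
by rewrite ltnn.
Qed.

(** A red point [o], another red point and a blue point always fit in an open
half-plane bounded by a line through [o], so [sector_corner] applies. *)
Lemma triangles_gt0 : (2 <= #|` Rd|)%N -> (0 < #|` Bl|)%N -> (0 < #|` E|)%N.
Proof.
move=> n2 m0.
have /fset0Pn[o oR] : Rd != fset0 by rewrite -cardfs_gt0; lia.
have /fset0Pn[p] : (Rd `\ o)%fset != fset0.
  by rewrite -cardfs_gt0; move: n2; rewrite (cardfsD1 o) oR; lia.
rewrite !inE => /andP[po pR].
have /fset0Pn[b bB] : Bl != fset0 by rewrite -cardfs_gt0.
have bP : b \in P by rewrite inE bB orbT.
have pP : p \in P by rewrite inE pR.
have oP : o \in P by rewrite inE oR.
have bR : b \notin Rd by rewrite -blueP.
have bo : o != b by apply: contraNneq bR => <-.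
have bp : p != b by apply: contraNneq bR => <-.
have [w wp wb] : exists2 w, ccw o w p & ccw o w b.
  have /ccw_total/orP[pb|bp'] : orient o p b != 0.
    by apply: (general_position_orient gp); rewrite // eq_sym.
  (* The direction [p - b] makes both determinants equal to that of [p], [b]. *)
  - exists (o + p - b); move: pb; rewrite /ccw /orient !mxE => h; lra.
  - exists (o + b - p); move: bp'; rewrite /ccw /orient !mxE => h; lra.
have [K sK memK] := sector_full w oR.
have : (0 < corners o K)%N.
  apply: sector_corner sK _ _ => //; apply/hasP.
  - by exists p; rewrite ?memK ?pP.
  - by exists b; rewrite ?memK ?bP.
by move=> h; apply: leq_trans h _; exact: count_size.
Qed.

End Fan.

Theorem theorem1 (R : realType) :
  exists c : R, 0 < c /\
    forall (m n : nat) (Rd Bl : {fset 'rV[R]_2}),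
      (2 <= n)%N -> (n <= m)%N ->
      #|` Rd| = n -> #|` Bl| = m ->
      [disjoint Rd & Bl]%fset ->
      general_position (Rd `|` Bl)%fset ->
      c * n%:R `^ (3 / 2) <= #|` empty_red_red_blue_triangles Rd Bl|%:R.
Proof.
exists (128%:R^-1); split; first by rewrite invr_gt0 ltr0n.
move=> m n Rd Bl n2 nm Rn Bm dis gp.
set T := #|` _|.
have [k [kn nk]] := nat_sqrt n.
have Tkn : (k * n <= 64 * T)%N.
  (* For [n < 4] the halving line degenerates, but then [k * n <= 3]. *)
  have [n4|n4] := leqP 4 n; last first.
    have := triangles_gt0 dis gp; rewrite Rn Bm -/T; nia.
  have [|o oR] := @low_degree_red _ Rd Bl; first by rewrite Rn; lia.
  have := apex_bound dis gp (o := o) k oR; rewrite Rn Bm -/T => /(_ n4 nm).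
  nia.
have sqrt_n : Num.sqrt (n%:R : R) <= (2 * k)%:R.
  rewrite -(ger0_norm (ler0n R (2 * k))) -sqrtr_sqr ler_wsqrtr//.
  rewrite -natrX ler_nat; nia.
have -> : (n%:R : R) `^ (3 / 2) = n%:R * Num.sqrt n%:R.
  have -> : 3 / 2 = 1 + 2^-1 :> R by lra.
  rewrite powRD; last by apply/implyP => _; rewrite pnatr_eq0; lia.
  by rewrite powRr1 ?ler0n// powR12_sqrt ?ler0n.
rewrite mulrC ler_pdivrMr ?ltr0n//; apply: (@le_trans _ _ (n%:R * (2 * k)%:R)).
  by rewrite ler_wpM2l ?ler0n.
by rewrite -!natrM ler_nat; lia.
Qed.
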